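(* Let $G$ be a $2$-connected graph, and let $L(G)$ denote its line graph. Then (1) $\omega_3(G)\leq \pi_3(L(G))$; (2) $\omega_3(L(G))\geq \omega_3(G)-1$; (3) $\pi_3(L(L(G)))\geq \pi_3(G)-1$.
   Context: All graphs are finite, simple and undirected. For a graph $G$ and a set $S\subseteq V(G)$ with $|S|\geq 2$, an $S$-path is a subgraph $P$ of $G$ that is a path with $S\subseteq V(P)$. Two $S$-paths $P,P'$ are internally disjoint if $E(P)\cap E(P')=\varnothing$ and $V(P)\cap V(P')=S$; they are edge-disjoint if $E(P)\cap E(P')=\varnothing$. $\pi_G(S)$ is the maximum number of pairwise internally disjoint $S$-paths in $G$, and $\omega_G(S)$ is the maximum number of pairwise edge-disjoint $S$-paths in $G$. For an integer $k$ with $2\leq k\leq |V(G)|$, $\pi_k(G)=\min\{\pi_G(S): S\subseteq V(G), |S|=k\}$ (path $k$-connectivity) and $\omega_k(G)=\min\{\omega_G(S): S\subseteq V(G), |S|=k\}$ (path $k$-edge-connectivity). *)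

(* Defs.v *)
From mathcomp Require Import all_boot.

Set Implicit Arguments.
Unset Strict Implicit.
Unset Printing Implicit Defensive.

Record sgraph := SGraph {
  svertex :> finType;
  adj : rel svertex;
  adj_sym : symmetric adj;
  adj_irr : irreflexive adj }.

Definition edges (G : sgraph) : {set {set G}} :=
  [set e | [exists x, [exists y, adj x y && (e == [set x; y])]]].

Section LineGraph.
Variable G : sgraph.

Definition line_vertex : finType := {e : {set G} | e \in edges G}.

Definition line_adj (e f : line_vertex) : bool :=
  (e != f) && (val e :&: val f != set0).

Lemma line_adj_sym : symmetric line_adj.
Proof. by move=> e f; rewrite /line_adj eq_sym setIC. Qed.

Lemma line_adj_irr : irreflexive line_adj.
Proof. by move=> e; rewrite /line_adj eqxx. Qed.

Definition line_graph : sgraph := SGraph line_adj_sym line_adj_irr.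
End LineGraph.

Definition vertex_connected (k : nat) (G : sgraph) : Prop :=
  k < #|G| /\
  forall X : {set G}, #|X| < k ->
  forall x y : G, x \notin X -> y \notin X ->
  connect [rel u v | [&& adj u v, u \notin X & v \notin X]] x y.

(* A candidate subgraph, given by its vertex set and its edge set. *)
Notation subgraph_of G := (({set G} * {set {set G}})%type).

Section Paths.
Variable G : sgraph.
Implicit Types (P Q : subgraph_of G) (S : {set G}) (F : {set subgraph_of G}).

Definition is_subgraph P : bool :=
  (P.2 \subset edges G) && [forall e in P.2, e \subset P.1].

Definition consecutive_pairs (s : seq G) : {set {set G}} :=
  [set e in [seq [set p.1; p.2] | p <- zip s (behead s)]].

(* The tuple lists the vertices of P in the order in which the path visits
   them, so its length can be fixed to the number of vertices of P. *)
Definition is_path P : bool :=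
  [&& is_subgraph P, P.1 != set0 &
    [exists s : #|P.1|.-tuple G,
      [&& uniq s, P.1 == [set x in s] & P.2 == consecutive_pairs s]]].

Definition is_Spath S P : bool := is_path P && (S \subset P.1).

Definition edge_disjoint P Q : bool := P.2 :&: Q.2 == set0.

Definition internally_disjoint S P Q : bool :=
  edge_disjoint P Q && (P.1 :&: Q.1 == S).

Definition pairwise_in (r : rel (subgraph_of G)) F : bool :=
  [forall P in F, forall Q in F, (P != Q) ==> r P Q].

Definition pi_set S : nat :=
  \max_(F : {set subgraph_of G} |
         [forall P in F, is_Spath S P] && pairwise_in (internally_disjoint S) F)
    #|F|.

Definition omega_set S : nat :=
  \max_(F : {set subgraph_of G} |
         [forall P in F, is_Spath S P] && pairwise_in edge_disjoint F)
    #|F|.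

(* The default value of the minimum is the number of all candidate subgraphs;
   it bounds pi_set and omega_set, so it does not affect the minimum as soon as
   k <= #|G| (see path_connectivityP and path_edge_connectivityP). *)
Definition path_connectivity (k : nat) : nat :=
  \big[minn/#|{: subgraph_of G}|]_(S : {set G} | #|S| == k) pi_set S.

Definition path_edge_connectivity (k : nat) : nat :=
  \big[minn/#|{: subgraph_of G}|]_(S : {set G} | #|S| == k) omega_set S.

Lemma big_minn_attained (f : {set G} -> nat) (b k : nat) :
  (forall S, f S <= b) -> k <= #|G| ->
  let m := \big[minn/b]_(S : {set G} | #|S| == k) f S in
  (exists2 S : {set G}, #|S| = k & m = f S) /\
  (forall S : {set G}, #|S| = k -> m <= f S).
Proof.
move=> fb kG m.
have lem S : #|S| = k -> m <= f S.
  move=> Sk; rewrite /m -big_filter.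
  have: S \in [seq S' <- index_enum _ | #|S' : {set G}| == k].
    by rewrite mem_filter Sk eqxx mem_index_enum.
  elim: [seq _ <- _ | _] => [//|T s IH].
  rewrite inE big_cons => /orP[/eqP->|/IH]; first exact: geq_minl.
  exact: leq_trans (geq_minr _ _).
split=> //.
have [S0 S0k] : exists S : {set G}, #|S| = k.
  exists [set x in take k (enum G)].
  rewrite cardsE; move/card_uniqP: (take_uniq k (enum_uniq G)) => ->.
  by rewrite size_takel -?cardE.
have : (exists2 S : {set G}, #|S| = k & m = f S) \/ m = b.
  rewrite /m; elim/big_ind: _ => [|x y Hx Hy|S /eqP Sk]; first by right.
    by rewrite /minn; case: ltnP.
  by left; exists S.
case=> // mb; exists S0 => //; apply/eqP.
by rewrite eqn_leq lem // mb fb.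
Qed.

Lemma path_connectivityP (k : nat) : k <= #|G| ->
  (exists2 S : {set G}, #|S| = k & path_connectivity k = pi_set S) /\
  (forall S : {set G}, #|S| = k -> path_connectivity k <= pi_set S).
Proof.
by apply: big_minn_attained => S; apply/bigmax_leqP => F _; apply: max_card.
Qed.

Lemma path_edge_connectivityP (k : nat) : k <= #|G| ->
  (exists2 S : {set G}, #|S| = k & path_edge_connectivity k = omega_set S) /\
  (forall S : {set G}, #|S| = k -> path_edge_connectivity k <= omega_set S).
Proof.
by apply: big_minn_attained => S; apply/bigmax_leqP => F _; apply: max_card.
Qed.

End Paths.

(* Main.v *)
Require Import Defs.
From mathcomp Require Import all_boot.

Set Implicit Arguments.
Unset Strict Implicit.
Unset Printing Implicit Defensive.

(** Let [S] consist of three edges of [G], and let [r] pick distinct endpoints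
    [r e], for [e] in [S]; put [T = r(S)]. The edges of a [T]-path [P] of [G], in
    order, form a path of the line graph; inserting each [e] in [S] that is not
    an edge of [P] when [P] visits [r e] makes it an [S]-path whose vertex set is
    [S] together with the edges of [P]. Edge-disjoint [T]-paths thus become
    [S]-paths that meet only in [S]. If [e] and [f] in [S] were consecutive on
    two of these, say with [e] on the first [T]-path and [f] on the second, then
    [r f] would lie in [e] and [r e] in [f], whence [e = {r e, r f} = f]. This
    proves (1) whenever [G] has at least three vertices. Since internally
    disjoint paths are edge-disjoint, (2) and (3) follow by applying (1) to [G]
    and to its line graph. *)

(** * Edges, consecutive pairs and paths *)

Lemma set2_eq (T : finType) (x y a b : T) :
  [set x; y] = [set a; b] -> (x = a /\ y = b) \/ (x = b /\ y = a).
Proof.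
move=> E.
have: x \in [set a; b] by rewrite -E set21.
have: y \in [set a; b] by rewrite -E set22.
have: a \in [set x; y] by rewrite E set21.
have: b \in [set x; y] by rewrite E set22.
rewrite !inE.
by do 4![case/orP=> /eqP ?]; subst; auto.
Qed.

Section Graph.
Variable G : sgraph.
Implicit Types (x y : G) (s : seq G) (P : subgraph_of G) (S : {set G}).

Lemma set2_edges x y : ([set x; y] \in edges G) = adj x y.
Proof.
rewrite inE; apply/existsP/idP => [[a /existsP[b /andP[ab /eqP E]]]|xy].
  by case: (set2_eq E) => -[-> ->]; rewrite // adj_sym.
by exists x; apply/existsP; exists y; rewrite xy eqxx.
Qed.

Lemma edgesP (e : {set G}) :
  reflect (exists x y, adj x y /\ e = [set x; y]) (e \in edges G).
Proof.
rewrite inE; apply: (iffP existsP) => [[a /existsP[b /andP[ab /eqP ->]]]|].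
  by exists a, b.
by case=> a [b [ab ->]]; exists a; apply/existsP; exists b; rewrite ab eqxx.
Qed.

Lemma card_edge (e : {set G}) : e \in edges G -> #|e| = 2.
Proof.
case/edgesP=> x [y [xy ->]]; rewrite cards2; case: eqP => // E.
by rewrite E adj_irr in xy.
Qed.

Lemma consecutive_pairs1 x : consecutive_pairs [:: x] = set0.
Proof. by apply/setP=> e; rewrite !inE. Qed.

Lemma consecutive_pairs_cons x y s :
  consecutive_pairs (x :: y :: s) = [set x; y] |: consecutive_pairs (y :: s).
Proof. by apply/setP=> e; rewrite !inE. Qed.

Lemma consecutive_pairs_sub s e : e \in consecutive_pairs s -> e \subset s.
Proof.
elim: s => [|x [|y s] IH]; [by rewrite inE | by rewrite consecutive_pairs1 inE |].
rewrite consecutive_pairs_cons in_setU1 => /orP[/eqP->|he].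
  by apply/subsetP=> z; rewrite !inE => /orP[]/eqP->; rewrite eqxx ?orbT.
by apply/subsetP=> z /(subsetP (IH he)) zs; rewrite inE zs orbT.
Qed.

Lemma consecutive_pairs_rel (R : rel G) s x y :
  symmetric R -> sorted R s -> [set x; y] \in consecutive_pairs s -> R x y.
Proof.
move=> Rsym; elim: s => [|a [|b s] IH]; [by rewrite inE | by rewrite consecutive_pairs1 inE |].
case/andP=> ab bs; rewrite consecutive_pairs_cons in_setU1 => /orP[/eqP E|he].
  by case: (set2_eq E) => -[-> ->]; rewrite // Rsym.
exact: IH.
Qed.

Lemma consecutive_pairs_edges s :
  (consecutive_pairs s \subset edges G) = sorted (@adj G) s.
Proof.
elim: s => [|x [|y s] IH].
- by apply/subsetP=> e; rewrite inE.
- by rewrite consecutive_pairs1 sub0set.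
by rewrite consecutive_pairs_cons subUset sub1set set2_edges IH.
Qed.

(** A plain sequence avoids a tuple length depending on [P.1]; adjacency along it takes over the
    subgraph condition. *)
Lemma is_pathP P :
  reflect (exists s, [/\ s != [::], uniq s, sorted (@adj G) s &
                         P = ([set x in s], consecutive_pairs s)])
          (is_path P).
Proof.
apply: (iffP and3P) => [[/andP[sub _] ne /existsP[s]]|[s [ne us ss ->]]].
  case: P sub ne s => V E /= sub ne s /and3P[us /eqP VE /eqP EE].
  exists (tval s); split=> //; last by rewrite -EE -VE.
    apply: contraNneq ne => s0; rewrite VE.
    by apply/eqP/setP=> x; rewrite !inE -[x \in s]/(x \in tval s) s0.
  by rewrite -consecutive_pairs_edges -EE.
split=> /=.
- rewrite /is_subgraph /= consecutive_pairs_edges ss /=.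
  apply/forall_inP=> e /consecutive_pairs_sub/subsetP h.
  by apply/subsetP=> x /h; rewrite inE.
- case: s ne {us ss} => // x s _; apply/set0Pn; exists x.
  by rewrite !inE eqxx.
have sz : size s == #|[set x in s]| by rewrite cardsE (card_uniqP us).
by apply/existsP; exists (Tuple sz); rewrite us !eqxx.
Qed.

Lemma is_path_edges_neq0 P : is_path P -> 1 < #|P.1| -> P.2 != set0.
Proof.
case/is_pathP=> [[|x [|y s]]] [// _ us _ ->] /=.
  by rewrite (_ : [set _ in _] = [set x]) ?cards1 //; apply/setP=> y; rewrite !inE.
move=> _; apply/set0Pn; exists [set x; y].
by rewrite consecutive_pairs_cons setU11.
Qed.

Lemma is_Spath_edges_neq0 S P : 1 < #|S| -> is_Spath S P -> P.2 != set0.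
Proof.
move=> S1 /andP[pP sP]; apply: is_path_edges_neq0 => //.
exact: leq_trans S1 (subset_leq_card sP).
Qed.

(** * Inequalities for the numbers of disjoint paths *)

Lemma pi_set_le_omega_set S : pi_set S <= omega_set S.
Proof.
apply/bigmax_leqP => F /andP[FS FD].
apply: (@leq_bigmax_cond _ _ (fun F : {set subgraph_of G} => #|F|)).
rewrite FS /=; apply/forall_inP=> P PF; apply/forall_inP=> Q QF.
apply/implyP=> PQ.
have/forall_inP/(_ Q QF)/implyP/(_ PQ) := forall_inP FD P PF.
by case/andP.
Qed.

Lemma path_connectivity_le_edge k :
  path_connectivity G k <= path_edge_connectivity G k.
Proof.
apply: (big_ind2 (fun m n => m <= n)) => // [m1 m2 n1 n2 h1 h2|S _].
  by rewrite leq_min !geq_min h1 h2 orbT.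
exact: pi_set_le_omega_set.
Qed.

(** Each path has an edge, so edge-disjoint paths have distinct edge sets. This crude bound serves
    for comparison with the default value of the minimum. *)
Lemma omega_set_le_exp S : 1 < #|S| -> omega_set S <= 2 ^ #|edges G|.
Proof.
move=> S1; apply/bigmax_leqP => F /andP[/forall_inP FS /forall_inP FD].
have inj : {in F &, injective snd}.
  move=> P Q PF QF E; apply/eqP/idP; apply: contraT => PQ.
  have/forall_inP/(_ Q QF)/implyP/(_ PQ) := FD P PF.
  by rewrite /edge_disjoint -E setIid (negPf (is_Spath_edges_neq0 S1 (FS P PF))).
rewrite -card_powerset -(card_in_imset inj); apply/subset_leq_card/subsetP.
move=> _ /imsetP[P PF ->]; rewrite inE.
by case/andP: (FS P PF) => /and3P[/andP[]].
Qed.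

(** * Distinct endpoints of three edges *)

Lemma distinct_representatives (S : {set {set G}}) :
  S \subset edges G -> #|S| = 3 ->
  exists r : {set G} -> G, {in S, forall e, r e \in e} /\ {in S &, injective r}.
Proof.
move=> /subsetP SE S3; have {}SE e : e \in S -> e \in edges G := SE e.
have [e1 [e2 [e3 [ES n12 n13 n23]]]] : exists e1 e2 e3,
    [/\ S = [set e1; e2; e3], e1 != e2, e1 != e3 & e2 != e3].
  have /card_gt0P[e1 h1] : 0 < #|S| by rewrite S3.
  have : #|S :\ e1| == 2 by have := cardsD1 e1 S; rewrite S3 h1 add1n => -[<-].
  case/cards2P=> e2 [e3 [n23 E]]; exists e1, e2, e3.
  have : e2 \in S :\ e1 by rewrite E set21.
  have : e3 \in S :\ e1 by rewrite E set22.
  rewrite !inE => /andP[n31 _] /andP[n21 _].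
  by split=> //; [rewrite -setUA -E setD1K | rewrite eq_sym | rewrite eq_sym].
have [E1 [E2 E3]] : e1 \in edges G /\ e2 \in edges G /\ e3 \in edges G.
  by split; [|split]; apply: SE; rewrite ES !inE eqxx ?orbT.
(* Choose [x] in [e1] outside [e2], then [z] in [e3] avoiding [x], then [y] in [e2] avoiding [z];
   [y] differs from [x] because [x] is not in [e2]. *)
rewrite {}ES in SE *; have /set0Pn[x] : e1 :\: e2 != set0.
  apply: contraNneq n12 => /eqP; rewrite setD_eq0 => sub.
  by rewrite eqEcard sub !card_edge.
rewrite inE => /andP[x2 x1].
have pick e y : e \in edges G -> exists2 z, z \in e & z != y.
  move=> eE; have /card_gt0P[z] : 0 < #|e :\ y|.
    by have := cardsD1 y e; rewrite card_edge //; case: #|e :\ y| (y \in e) => [[]|].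
  by rewrite !inE => /andP[zy ze]; exists z.
have [z z3 zx] := pick e3 x E3; have [y y2 yz] := pick e2 z E2.
have yx : y != x by apply: contraNneq x2 => <-.
have [n21 n31 n32] : [/\ e2 != e1, e3 != e1 & e3 != e2].
  by rewrite !(eq_sym _ e1) (eq_sym e3).
exists (fun e => if e == e1 then x else if e == e2 then y else z); split.
  move=> e; rewrite !inE -orbA.
  by case/or3P=> /eqP->; rewrite ?eqxx ?(negPf n21) ?(negPf n31) ?(negPf n32) ?eqxx.
move=> e f; rewrite !inE -!orbA.
by move=> /or3P[]/eqP-> /or3P[]/eqP->; rewrite ?eqxx ?(negPf n21) ?(negPf n31) ?(negPf n32) //;
  move=> E; move: zx yz yx; rewrite E eqxx.
Qed.

End Graph.

(** * Inserting edges of [S] into the edge sequence of a path *)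

Section Insertion.
Variables (G : sgraph) (S : {set {set G}}) (r : {set G} -> G).
Hypotheses (r_mem : {in S, forall e, r e \in e}) (r_inj : {in S &, injective r}).
Implicit Types (A : {set {set G}}) (e f : {set G}) (x y : G) (s : seq G).

(** As [r] is injective on [S], at most one edge qualifies, so the choice made by [pick] is
    forced. *)
Definition inserted A x : seq {set G} :=
  if [pick e in S | (r e == x) && (e \notin A)] is Some e then [:: e] else [::].

(** [A] is meant to be the edge set of the whole path and stays fixed in the recursion, so that an
    edge of [S] traversed elsewhere is not inserted again. *)
Fixpoint line_trail A x s : seq {set G} :=
  inserted A x ++ if s is y :: s' then [set x; y] :: line_trail A y s' else [::].

(** Beyond adjacency in the line graph, the last three clauses record how neighbours in a trail
    arise: one of them is an edge of the path, and one that is not was inserted at its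
    representative. *)
Definition trail_adj A : rel {set G} := fun e f =>
  [&& e != f, e :&: f != set0, (e \in A) || (f \in A),
      (e \notin A) ==> (r e \in f) & (f \notin A) ==> (r f \in e)].

Lemma trail_adj_sym A : symmetric (trail_adj A).
Proof.
by move=> e f; rewrite /trail_adj eq_sym setIC orbC; do !bool_congr; rewrite andbC.
Qed.

Lemma trail_adj_disjoint A B e f :
  e \in S -> f \in S -> #|e| = 2 -> #|f| = 2 -> A :&: B = set0 ->
  trail_adj A e f -> ~~ trail_adj B e f.
Proof.
move=> eS fS e2 f2 AB /and5P[ef _ eA reA rfA]; apply/negP=> /and5P[_ _ eB reB rfB].
have notAB g : g \in A -> g \notin B.
  by move=> gA; apply/negP=> gB; move/setP/(_ g): AB; rewrite !inE gA gB.
(* If [e] is in [A], it is not in [B], so [f] is in [B] and not in [A]; the other case is symmetric.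
   Thus [A] and [B] each supply one membership. *)
have [rf re] : r f \in e /\ r e \in f.
  case/orP: eA => [eA|fA].
    move: eB; rewrite (negPf (notAB _ eA)) /= => fB.
    rewrite (notAB _ eA) /= in reB; split=> //.
    by apply: (implyP rfA); apply: contraL fB; apply: notAB.
  move: eB; rewrite (negPf (notAB _ fA)) orbF => eB.
  rewrite (notAB _ fA) /= in rfB; split=> //.
  by apply: (implyP reA); apply: contraL eB; apply: notAB.
have rerf : r e != r f by apply: contra_neq ef; apply: r_inj.
have full (g : {set G}) : r e \in g -> r f \in g -> #|g| = 2 -> g = [set r e; r f].
  move=> h1 h2 g2; apply/esym/eqP; rewrite eqEcard g2 cards2 rerf andbT.
  by rewrite subUset !sub1set h1.
by case/eqP: ef; apply: etrans (full e _ _ _) (esym (full f _ _ _)); rewrite // r_mem.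
Qed.

Lemma mem_inserted A x e :
  (e \in inserted A x) = [&& e \in S, r e == x & e \notin A].
Proof.
rewrite /inserted; case: pickP => [f /and3P[fS /eqP fx fA]|/(_ e) /= h]; last by rewrite h.
rewrite inE; apply/eqP/and3P => [->|[eS /eqP ex eA]]; first by rewrite fx.
by apply: r_inj; rewrite ?ex ?fx.
Qed.

Lemma mem_line_trail A x s e :
  (e \in line_trail A x s) =
  (e \in consecutive_pairs (x :: s)) || [&& e \in S, r e \in x :: s & e \notin A].
Proof.
elim: s x => [|y s IH] x.
  by rewrite /= cats0 mem_inserted consecutive_pairs1 !inE.
rewrite /= mem_cat mem_inserted consecutive_pairs_cons in_setU1 in_cons IH 2!in_cons.
rewrite orbCA -!orbA; congr (_ || _); rewrite orbCA; congr (_ || _).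
by rewrite -andb_orr -andb_orl in_cons.
Qed.

Lemma line_trail_uniq A x s :
  uniq (x :: s) -> consecutive_pairs (x :: s) \subset A -> uniq (line_trail A x s).
Proof.
have ins_uniq z : uniq (inserted A z) by rewrite /inserted; case: pickP.
elim: s x => [|y s IH] x us; first by rewrite /= cats0 ins_uniq.
rewrite consecutive_pairs_cons subUset sub1set => /andP[xyA sA].
have [xs uys] := andP us.
rewrite /= cat_uniq ins_uniq /= IH // andbT negb_or mem_inserted xyA !andbF /=.
(* An edge inserted at [x] is outside [A] and represented by [x], which is not visited again; for
   the latter reason the edge from [x] to [y] cannot recur either. *)
apply/andP; split.
  apply/hasPn=> e; rewrite mem_line_trail mem_inserted /=.
  case/orP=> [he|/and3P[_ rs _]]; first by rewrite (subsetP sA) // !andbF.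
  by case: eqP => [E|]; rewrite ?andbF //; rewrite -E rs in xs.
rewrite mem_line_trail xyA !andbF orbF; apply: contra xs => /consecutive_pairs_sub.
by move/subsetP; apply; rewrite set21.
Qed.

Lemma trail_adj_inserted A x e f :
  f \in A -> x \in f -> e \in inserted A x -> trail_adj A f e.
Proof.
move=> fA xf; rewrite mem_inserted => /and3P[eS /eqP rx eA].
rewrite /trail_adj fA eA rx xf /= andbT.
apply/andP; split; first by apply: contraNneq eA => <-.
by apply/set0Pn; exists x; rewrite inE xf -rx r_mem.
Qed.

(** Keeping the edge by which [y] is entered as head lets the induction treat a vertex where nothing
    is inserted: there two consecutive edges of the path become neighbours. *)
Lemma line_trail_path A x y s :
  uniq [:: x, y & s] -> consecutive_pairs [:: x, y & s] \subset A ->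
  path (trail_adj A) [set x; y] (line_trail A y s).
Proof.
elim: s x y => [|z s IH] x y us; rewrite consecutive_pairs_cons subUset sub1set.
  case/andP=> xyA _; rewrite /= cats0; have := @trail_adj_inserted A y ^~ [set x; y].
  by rewrite /inserted; case: pickP => //= e _ -> //; rewrite ?set22 ?mem_head.
case/andP=> xyA sA; have [xs uys] := andP us.
have yzA : [set y; z] \in A by apply: (subsetP sA); rewrite consecutive_pairs_cons setU11.
rewrite /=; have := @trail_adj_inserted A y.
rewrite /inserted; case: pickP => [e _|_] h /=.
  by rewrite IH // andbT (h _ [set x; y]) 1?trail_adj_sym ?(h _ [set y; z]) ?set21 ?set22 ?mem_head.
rewrite IH // andbT /trail_adj xyA yzA /= andbT; apply/andP; split.
  apply: contraNneq xs => /setP/(_ x); rewrite set21 => /esym.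
  by rewrite !inE => /orP[]->; rewrite ?orbT.
by apply/set0Pn; exists y; rewrite !inE eqxx ?orbT.
Qed.

Lemma line_trail_sorted A x s :
  uniq (x :: s) -> consecutive_pairs (x :: s) \subset A ->
  sorted (trail_adj A) (line_trail A x s).
Proof.
case: s => [|y s] us sA; first by rewrite /= cats0 /inserted; case: pickP.
have := line_trail_path us sA.
move: sA; rewrite consecutive_pairs_cons subUset sub1set => /andP[xyA _].
rewrite /=; have := @trail_adj_inserted A x.
rewrite /inserted; case: pickP => [e _|_] //= h ->.
by rewrite trail_adj_sym h ?set21 ?mem_head.
Qed.

End Insertion.

(** * Lifting paths to the line graph *)

Section Lift.
Variables (G : sgraph) (S : {set line_graph G}) (r : {set G} -> G).
Let S0 : {set {set G}} := val @: S.
Hypotheses (r_mem : {in S0, forall e, r e \in e}) (r_inj : {in S0 &, injective r}).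
Implicit Types (P : subgraph_of G) (Q : subgraph_of (line_graph G)).

(** The vertex set is fixed exactly, while of the edges only [trail_adj] is kept; this suffices to
    control how two lifts meet. *)
Definition is_lift P Q : bool :=
  [&& is_Spath S Q, Q.1 == S :|: [set e | val e \in P.2] &
   [forall e, forall f, ([set e; f] \in Q.2) ==> trail_adj r P.2 (val e) (val f)]].

Lemma Spath_lift P : S != set0 -> is_Spath (r @: S0) P -> exists Q, is_lift P Q.
Proof.
move=> S_neq0 /andP[/is_pathP[[|x s] [// _ us ss ->]] /= /subsetP rS].
set A := consecutive_pairs (x :: s).
pose t := line_trail S0 r A x s.
have At : A \subset edges G by rewrite consecutive_pairs_edges.
have S0E e : e \in S0 -> e \in edges G by case/imsetP=> f _ ->; apply: (valP f).
have tE : all [in edges G] t.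
  apply/allP=> e; rewrite mem_line_trail // => /orP[/(subsetP At)//|/and3P[/S0E//]].
(* All members of [t] are edges, so [insub] discards nothing. *)
pose u : seq (line_graph G) := pmap insub t.
have ut : map val u = t.
  rewrite /u (pmap_filter (insubK _)); apply/all_filterP; apply: sub_all tE => e eE /=.
  by rewrite insubT.
have mem_u e : (e \in u) = (val e \in t) by rewrite -ut mem_map //; apply: val_inj.
have uniq_t : uniq t by apply: line_trail_uniq.
have sorted_t : sorted (trail_adj r A) t by apply: line_trail_sorted.
have sorted_u : sorted (fun e f : line_graph G => trail_adj r A (val e) (val f)) u.
  by rewrite -ut sorted_map in sorted_t.
have u_mem : [set e in u] = S :|: [set e | val e \in A].
  have t_mem := mem_line_trail r_inj A x s; rewrite -/A -/t in t_mem.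
  clearbody t A; apply/setP=> e; rewrite !inE mem_u t_mem orbC.
  rewrite (mem_imset _ _ val_inj).
  case eS: (e \in S) => //=; case: (val e \in A); rewrite ?orbT ?andbT ?orbF //.
  have := rS (r (val e)); rewrite inE => -> //.
  by rewrite !imset_f.
exists ([set e in u], consecutive_pairs u); rewrite /is_lift; apply/and3P; split=> /=; last 2 first.
- by rewrite u_mem.
- apply/forallP=> e; apply/forallP=> f; apply/implyP.
  by apply: consecutive_pairs_rel sorted_u => e' f'; apply: trail_adj_sym.
rewrite /is_Spath u_mem subsetUl andbT -u_mem; apply/is_pathP; exists u; split=> //.
- case/set0Pn: S_neq0 => e eS; have : e \in [set e in u] by rewrite u_mem inE eS.
  by rewrite inE; case: (u).
- by rewrite -(map_inj_uniq val_inj) ut.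
- apply: sub_sorted sorted_u => e f /and5P[ef ef0 _ _ _].
  by rewrite /= /line_adj ef0 andbT; apply: contra_neq ef => ->.
Qed.

End Lift.

(** * The main inequality between a graph and its line graph *)

Lemma path_edge_connectivity_le_line_graph (G : sgraph) : 3 <= #|G| ->
  path_edge_connectivity G 3 <= path_connectivity (line_graph G) 3.
Proof.
move=> G3; have [[T0 T03 T0E] omega_min] := path_edge_connectivityP G3.
rewrite /path_connectivity.
elim/big_ind: _ => [|m n hm hn|S /eqP S3]; last 1 first.
- have S0E : val @: S \subset edges G.
    by apply/subsetP=> _ /imsetP[e _ ->]; apply: (valP e).
  have S03 : #|val @: S| = 3 by rewrite card_imset //; apply: val_inj.
  have [r [r_mem r_inj]] := distinct_representatives S0E S03.
  set T := r @: (val @: S).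
  have T3 : #|T| = 3 by rewrite card_in_imset.
  apply: leq_trans (omega_min T T3) _.
  apply/bigmax_leqP => F /andP[/forall_inP FT /forall_inP FD].
  have S_neq0 : S != set0 by rewrite -card_gt0 S3.
  pose lift P := odflt (set0, set0) [pick Q | is_lift S r P Q].
  have liftP P : P \in F -> is_lift S r P (lift P).
    move=> /FT/(Spath_lift r_mem r_inj S_neq0)[Q PQ].
    by rewrite /lift; case: pickP => [//|/(_ Q)]; rewrite PQ.
  have lift_disj P Q : P \in F -> Q \in F -> P != Q ->
      internally_disjoint S (lift P) (lift Q).
    move=> PF QF PQ.
    have/forall_inP/(_ Q QF)/implyP/(_ PQ)/eqP disj := FD P PF.
    have /and3P[/andP[pP _] /eqP P1 /forallP P2] := liftP P PF.
    have /and3P[/andP[pQ _] /eqP Q1 /forallP Q2] := liftP Q QF.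
    have V : (lift P).1 :&: (lift Q).1 = S.
      rewrite P1 Q1 -setUIr; apply/setUidPl/subsetP=> e; rewrite !inE => PQe.
      by move/setP/(_ (val e)): disj; rewrite !inE PQe.
    rewrite /internally_disjoint V eqxx andbT; apply/set0Pn=> -[g].
    case/setIP=> gP gQ.
    have {pP} /and3P[/andP[/subsetP/(_ g gP)/edgesP[e [f [ef gE]]] subP] _ _] := pP.
    have {pQ} /and3P[/andP[_ subQ] _ _] := pQ.
    (* The ends of a common edge [g] lie on both lifts, which share only [S]; hence
       [trail_adj_disjoint] applies to them. *)
    have /subsetP gS : g \subset S.
      by rewrite -V subsetI (forall_inP subP) // (forall_inP subQ).
    have [eS fS] : e \in S /\ f \in S by split; apply: gS; rewrite gE !inE eqxx ?orbT.
    have adjP := implyP (forallP (P2 e) f); have adjQ := implyP (forallP (Q2 e) f).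
    rewrite -gE in adjP adjQ.
    have := trail_adj_disjoint r_mem r_inj (imset_f _ eS) (imset_f _ fS)
      (card_edge (valP e)) (card_edge (valP f)) disj (adjP gP).
    by rewrite adjQ.
  (* A lift shared by two paths would be edge-disjoint from itself, yet it has an edge. *)
  have lift_inj : {in F &, injective lift}.
    move=> P Q PF QF E; apply/eqP; apply: contraT => PQ.
    have /andP[] := lift_disj P Q PF QF PQ.
    have /and3P[PS _ _] := liftP P PF.
    rewrite /edge_disjoint -E setIid => /negP[]; apply/negP.
    by apply: is_Spath_edges_neq0 PS; rewrite S3.
  rewrite -(card_in_imset lift_inj).
  apply: (@leq_bigmax_cond _ _ (fun F : {set subgraph_of (line_graph G)} => #|F|)).
  apply/andP; split.
    by apply/forall_inP=> _ /imsetP[P PF ->]; case/and3P: (liftP P PF).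
  apply/forall_inP=> _ /imsetP[P PF ->]; apply/forall_inP=> _ /imsetP[Q QF ->].
  by apply/implyP=> PQ; apply: lift_disj => //; apply: contra_neq PQ => ->.
(* The default value counts all candidate subgraphs of the line graph; their possible vertex sets
   alone number [2 ^ #|edges G|]. *)
- rewrite T0E; apply: leq_trans (omega_set_le_exp _) _; first by rewrite T03.
  have EL : #|edges G| = #|line_graph G| by rewrite card_sig.
  rewrite EL -cardsT -card_powerset powersetT cardsT card_prod leq_pmulr //.
  by apply/card_gt0P; exists set0.
- by rewrite leq_min hm hn.
Qed.

(** * Edges of a 2-connected graph and the theorem *)

Lemma vertex_connected2_neighbour (G : sgraph) (x u : G) :
  vertex_connected 2 G -> x != u -> exists2 v, adj x v & v != u.
Proof.
case=> G3 conn xu.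
have /card_gt0P[y] : 0 < #|~: [set x; u]|.
  by have := cardsC [set x; u]; rewrite cards2 xu => E; rewrite -E in G3; case: #|_| G3.
rewrite !inE negb_or => /andP[yx yu].
(* After deleting [u], the first step of a walk from [x] to a third vertex [y] gives the
   neighbour. *)
have /connectP[[|v p] /= pth yE] :
    connect [rel a b | [&& adj a b, a \notin [set u] & b \notin [set u]]] x y.
- by apply: conn; rewrite ?cards1 // inE.
- by rewrite yE eqxx in yx.
by case/andP: pth => /and3P[xv _]; rewrite inE => vu _; exists v.
Qed.

(** This allows the main inequality to be applied to the line graph. To an edge [xy] add a second
    edge [xz] at [x] and a second edge [yw] at [y]; [z] and [w] may coincide. *)
Lemma vertex_connected2_edges (G : sgraph) :
  vertex_connected 2 G -> 3 <= #|line_graph G|.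
Proof.
move=> hG; have [G3 _] := hG.
have /card_gt1P[x [u [_ _ xu]]] : 1 < #|G| by apply: ltnW.
have [y xy _] := vertex_connected2_neighbour hG xu.
have adj_neq (a b : G) : adj a b -> a != b by apply: contraTneq => ->; rewrite adj_irr.
have [z xz zy] := vertex_connected2_neighbour hG (adj_neq _ _ xy).
have yx : y != x by rewrite eq_sym adj_neq.
have [w yw wx] := vertex_connected2_neighbour hG yx.
rewrite card_sig.
have sub : [set [set x; y]; [set x; z]; [set y; w]] \subset edges G.
  by rewrite !subUset !sub1set !set2_edges xy xz yw.
apply: leq_trans (subset_leq_card sub).
have z_yw : z \notin [set x; y] by rewrite !inE negb_or zy eq_sym adj_neq.
have n12 : [set x; y] != [set x; z] by apply: contraNneq z_yw => ->; rewrite set22.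
have x_yw : x \notin [set y; w] by rewrite !inE negb_or (eq_sym x w) wx eq_sym yx.
have n13 : [set x; y] != [set y; w] by apply: contraNneq x_yw => <-; rewrite set21.
have n23 : [set x; z] != [set y; w] by apply: contraNneq x_yw => <-; rewrite set21.
by rewrite -setUA cardsU1 cards2 n23 !inE negb_or n12 n13.
Qed.

Theorem theorem2p4 (G : sgraph) (hG : vertex_connected 2 G) :
  [/\ path_edge_connectivity G 3 <= path_connectivity (line_graph G) 3,
      path_edge_connectivity (line_graph G) 3 >= path_edge_connectivity G 3 - 1
    & path_connectivity (line_graph (line_graph G)) 3
        >= path_connectivity G 3 - 1].
Proof.
have h1 := path_edge_connectivity_le_line_graph (proj1 hG).
have h2 := path_edge_connectivity_le_line_graph (vertex_connected2_edges hG).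
(* With [h2], this completes the chain from path 3-edge-connectivity of [G] through [line_graph G]
   to path 3-connectivity of the iterated line graph. *)
have h3 := leq_trans h1 (path_connectivity_le_edge (line_graph G) 3).
split=> //; first exact: leq_trans (leq_subr _ _) h3.
apply: leq_trans (leq_subr _ _) (leq_trans (path_connectivity_le_edge G 3) _).
exact: leq_trans h3 h2.
Qed.
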